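(* Let $\Gamma$ be a tropical curve, and let $p \in \Gamma$ be a basepoint. Then the Abel-Jacobi map $\Phi_p: \Gamma \to J(\Gamma)$ is a tropical isometry along any segment $e$ of $\Gamma$ that is not collapsed to a point by $\Phi_p$; that is, the differential of $\Phi_p$ carries unit-length tangent vectors along $e$ to vectors of tropical length $1$, so that the length of the image segment $\Phi_p(e)$ in the tropical metric equals $\ell(e)$.
   Context: A weighted graph $G$ is a finite connected multigraph (loops and multiple edges allowed) with finite vertex set $V(G)\ne\emptyset$, finite edge set $E(G)$, lengths $\ell : E(G) \to \mathbb{R}_{>0}$, and an orientation: each edge $e$ has tail $e^-$ and head $e^+$. $C_1(G,A)$ is the free $A$-module on $E(G)$ ($A=\mathbb{Z}$ or $\mathbb{R}$); $(d^*\alpha)(x) = \sum_{e^+ = x}\alpha(e) - \sum_{e^-=x}\alpha(e)$; $H_1(G,A) = \ker(d^* )\cap C_1(G,A)$. A 1-form $\omega = \sum_e \omega_e\, de$ (formal real combination) is harmonic if $\sum_{e^+=x}\omega_e = \sum_{e^-=x}\omega_e$ for all vertices $x$; $\Omega(G)$ is the space of harmonic 1-forms. Integration is bilinear with $\int_{e'} de = \ell(e)$ if $e=e'$, else $0$; each $\alpha\in C_1(G,\mathbb{R})$ gives $\int_\alpha\in\Omega(G)^*$, and $\alpha\mapsto\int_\alpha$ is an isomorphism $H_1(G,\mathbb{R})\cong\Omega(G)^*$. If $G'$ is obtained from $G$ by length-preserving subdivision of edges with induced orientation (a refinement), with $e$ subdivided into $e_1,\dots,e_n$, then $r(e)=\sum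 e_i$ and $r_*(de)=\sum de_i$ induce isomorphisms $H_1(G,\mathbb{Z})\cong H_1(G',\mathbb{Z})$, $\Omega(G)\cong\Omega(G')$, compatible with integration. A tropical curve $\Gamma$ is a compact connected metric graph of finite total length, with a preferred model $G_0$ (a weighted graph whose geometric realization, gluing segments $[0,\ell(e)]$, is $\Gamma$); all other models are taken to have a common refinement with $G_0$. A segment of $\Gamma$ is the realization of an edge $e$ of $G_0$, of length $\ell(e)$. $\Omega(\Gamma)\cong\Omega(G_0)$ is the direct limit of $\Omega(G)$ over models $G$, $H_1(\Gamma,\mathbb{Z})=H_1(G_0,\mathbb{Z})$ is embedded in $\Omega(\Gamma)^*$ by integration, and $J(\Gamma) = \Omega(\Gamma)^*/H_1(\Gamma,\mathbb{Z})$. Abel-Jacobi map: for $q\in\Gamma$ choose a model $G$ having $p$ and $q$ as vertices and a path $P$ in $G$ from $p$ to $q$, let $\alpha_P\in C_1(G,\mathbb{Z})$ be the signed count of traversals of each edge by $P$; $\Phi_p(q)$ is the class of $\int_{\alpha_P}\in\Omega(G)^*\cong\Omega(\Gamma)^*$ in $J(\Gamma)$. This is independent of choices and continuous. Tropical structure and tropical metric: $\Omega_{\mathbb{Z}}(\Gamma)$ is the lattice of harmonic 1-forms $\sum\omega_e\,de$ with all $\omega_e\in\mathbb{Z}$, and $\Omega_{\mathbb{Z}}(\Gamma)^* = \{s\in\Omega(\Gamma)^* : s(\omega)\in\mathbb{Z}\ \forall\omega\in\Omega_{\mathbb{Z}}(\Gamma)\}$. A vector $\lambda\in\Omega_{\mathbb{Z}}(\Gamma)^*$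 is primitive if it is not $t\lambda'$ with $\lambda'\in\Omega_{\mathbb{Z}}(\Gamma)^*$ and $t>1$ an integer. For $v=t\lambda$ with $t\in\mathbb{R}$ and $\lambda$ primitive, the tropical length is $\|v\|_{\mathbb{Z}}=|t|$. If $t\in[0,\ell(e)]$ is the unit-speed coordinate on a segment $e$, the path $t\mapsto\Phi_p(e(t))$ lifts to an affine path $t\mapsto v+t\lambda_e$ in $\Omega(\Gamma)^*$ with $\lambda_e$ a real multiple of an element of $\Omega_{\mathbb{Z}}(\Gamma)^*$; $\lambda_e$ is the image under the differential of the unit tangent vector, and the tropical length of the image segment $\Phi_p(e)$ is that of the lifted segment, $\ell(e)\|\lambda_e\|_{\mathbb{Z}}$. *)

(* Defs.v *)
From HB Require Import structures.
From mathcomp Require Import all_boot all_order all_algebra.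
From mathcomp Require Import all_classical reals.

Set Implicit Arguments.
Unset Strict Implicit.
Unset Printing Implicit Defensive.

Import Order.TTheory GRing.Theory Num.Theory.

Local Open Scope ring_scope.

Record wgraph (R : realType) := WGraph {
  vtx : finType;
  edge : finType;
  edge_tail : edge -> vtx;
  edge_head : edge -> vtx;
  len : edge -> R;
  len_gt0 : forall e, 0 < len e;
  vtx_neq0 : (0 < #|vtx|)%N;
  wgraph_connected : forall x y : vtx,
    connect (fun a b => [exists e, ((edge_tail e == a) && (edge_head e == b))
                                || ((edge_tail e == b) && (edge_head e == a))]) x y
}.

Definition boundary (R : realType) (G : wgraph R) (A : zmodType)
    (a : {ffun edge G -> A}) (x : vtx G) : A :=
  \sum_(e | edge_head e == x) a e - \sum_(e | edge_tail e == x) a e.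

(* The 1-form \sum_e w_e de is represented by its coefficients (w_e)_e; the   *)
(* harmonicity condition on coefficients is the vanishing of [boundary].      *)
Definition form (R : realType) (G : wgraph R) := {ffun edge G -> R^o}.

Definition boundary_form (R : realType) (G : wgraph R) (w : form G) :
  {ffun vtx G -> R^o} := [ffun x => boundary w x].

Fact boundary_form_is_linear (R : realType) (G : wgraph R) :
  linear (@boundary_form R G).
Proof.
move=> k u v; apply/ffunP => x; rewrite !ffunE /boundary.
under eq_bigr do rewrite !ffunE.
under [X in _ - X]eq_bigr do rewrite !ffunE.
by rewrite !big_split /= -!scaler_sumr scalerBr opprD addrACA.
Qed.

HB.instance Definition _ (R : realType) (G : wgraph R) :=
  GRing.isLinear.Build R (form G) {ffun vtx G -> R^o} _ (@boundary_form R G)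
    (@boundary_form_is_linear R G).

Definition Omega (R : realType) (G : wgraph R) : {vspace form G} :=
  lker (linfun (@boundary_form R G)).

Lemma OmegaP (R : realType) (G : wgraph R) (w : form G) :
  reflect (forall x, \sum_(e | edge_head e == x) w e = \sum_(e | edge_tail e == x) w e)
          (w \in Omega G).
Proof.
rewrite memv_ker lfunE /=; apply: (iffP eqP) => [/ffunP w0 x|wh].
  by have := w0 x; rewrite !ffunE => /eqP; rewrite subr_eq0 => /eqP.
by apply/ffunP => x; rewrite !ffunE /boundary wh subrr.
Qed.

Definition Omega_dual (R : realType) (G : wgraph R) :=
  'Hom(subvs_of (Omega G), R^o).

Definition integral (R : realType) (G : wgraph R)
    (a : {ffun edge G -> R}) (w : form G) : R :=
  \sum_e a e * w e * len e.

Definition real_chain (R : realType) (G : wgraph R)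
    (a : {ffun edge G -> int}) : {ffun edge G -> R} := [ffun e => (a e)%:~R].

Definition int_functional (R : realType) (G : wgraph R)
    (a : {ffun edge G -> R}) : Omega_dual G :=
  linfun (fun w : subvs_of (Omega G) => integral a (vsval w) : R^o).

Fact integral_is_linear (R : realType) (G : wgraph R)
    (a : {ffun edge G -> R}) (k : R) (u v : form G) :
  integral a (k *: u + v) = k * integral a u + integral a v.
Proof.
rewrite /integral mulr_sumr -big_split; apply: eq_bigr => e _ /=.
by rewrite !ffunE mulrDr mulrDl /GRing.scale /= mulrCA !mulrA.
Qed.

(* [linfun] only agrees with its argument on linear functions. *)
Lemma linfun_linearE (R : realType) (U : vectType R) (f : U -> R^o) :
  (forall k u v, f (k *: u + v) = k * f u + f v) -> linfun f =1 f.
Proof.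
move=> f_lin u.
pose f_mixin := GRing.isLinear.Build R U R^o _ f f_lin.
pose F : {linear U -> R^o} := HB.pack f f_mixin.
exact: (lfunE F u).
Qed.

Lemma int_functionalE (R : realType) (G : wgraph R)
    (a : {ffun edge G -> R}) (w : subvs_of (Omega G)) :
  int_functional a w = integral a (vsval w).
Proof.
by rewrite /int_functional linfun_linearE // => k u v; rewrite linearP integral_is_linear.
Qed.

Definition H1Z (R : realType) (G : wgraph R) : {pred Omega_dual G} :=
  fun s => `[< exists a : {ffun edge G -> int},
    (forall x, boundary a x = 0) /\ s = int_functional (real_chain a) >].

Fact H1Z_zmod_closed (R : realType) (G : wgraph R) : zmod_closed (@H1Z R G).
Proof.
split=> [|_ _ /asboolP[a [a0 ->]] /asboolP[b [b0 ->]]]; apply/asboolP.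
  exists 0; split=> [x|]; first by rewrite /boundary !big1 ?subrr // => e _; rewrite ffunE.
  apply/lfunP => w; rewrite lfunE /= int_functionalE /integral big1 // => e _.
  by rewrite !ffunE !mul0r.
exists (a - b); split=> [x|].
  have -> : boundary (a - b) x = boundary a x - boundary b x; last by rewrite a0 b0 subrr.
  rewrite /boundary; under eq_bigr do rewrite !ffunE.
  under [X in _ - X = _]eq_bigr do rewrite !ffunE.
  by rewrite !sumrB !opprB addrACA [RHS]addrACA; congr (_ + _); rewrite addrC.
apply/lfunP => w; rewrite !lfunE /= lfunE /= !int_functionalE /integral -sumrB.
by apply: eq_bigr => e _; rewrite !ffunE rmorphB /= !mulrBl.
Qed.

HB.instance Definition _ (R : realType) (G : wgraph R) :=
  GRing.isZmodClosed.Build (Omega_dual G) (@H1Z R G) (@H1Z_zmod_closed R G).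

Definition Jac (R : realType) (G : wgraph R) := {ideal_quot (@H1Z R G)}.

Definition toJac (R : realType) (G : wgraph R) (s : Omega_dual G) : Jac G :=
  (\pi_(Jac G) s)%qT.

(* The geometric realization of G, i.e. the segments [0, len e] glued at      *)
(* their ends, in normal form: a point is a vertex or a pair (e, t) with      *)
(* 0 < t < len e.                                                             *)
Definition curve_point (R : realType) (G : wgraph R) : Type :=
  (vtx G + {x : edge G * R | (0 < x.2 < len x.1)%R})%type.

(* Unit-speed coordinate e(t); only meaningful for 0 <= t <= len e. *)
Definition segment (R : realType) (G : wgraph R) (e : edge G) (t : R) :
    curve_point G :=
  if insub (e, t) is Some x then inr x
  else if t <= 0 then inl (edge_tail e) else inl (edge_head e).

(* G' refines G: the vertices of G' are placed injectively in the realization *)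
(* of G, all vertices of G being hit, and each edge e of G is cut into the    *)
(* edges of G' with host e.  The edge e' of G' is the subsegment              *)
(* [start e', start e' + len e'] of its host, with the induced orientation,   *)
(* and the half-open subsegments with host e partition [0, len e[.            *)
Record refinement (R : realType) (G G' : wgraph R) := Refinement {
  place : vtx G' -> curve_point G;
  host : edge G' -> edge G;
  start : edge G' -> R;
  place_inj : injective place;
  place_vtx : forall x : vtx G, exists y, place y = inl x;
  start_ge0 : forall e', 0 <= start e';
  end_le : forall e', start e' + len e' <= len (host e');
  place_tail : forall e', place (edge_tail e') = segment (host e') (start e');
  place_head :
    forall e', place (edge_head e') = segment (host e') (start e' + len e');
  host_cover : forall e t, 0 <= t < len e ->
    exists! e', host e' = e /\ start e' <= t < start e' + len e'
}.

(* With e subdivided into e_1, ..., e_n, both e |-> \sum_i e_i on chains and  *)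
(* de |-> \sum_i de_i on 1-forms give e' the coefficient of its host.         *)
Definition refine (R : realType) (G G' : wgraph R) (r : refinement G G')
    (A : Type) (c : {ffun edge G -> A}) : {ffun edge G' -> A} :=
  [ffun e' => c (host r e')].

(* [Gamma] is given by its preferred model. *)
Record model (R : realType) (Gamma : wgraph R) := Model {
  mgraph : wgraph R;
  mcommon : wgraph R;
  mref : refinement mgraph mcommon;
  mref0 : refinement Gamma mcommon
}.

Definition vertex_at (R : realType) (Gamma : wgraph R) (M : model Gamma)
    (x : vtx (mgraph M)) (q : curve_point Gamma) : Prop :=
  exists y, place (mref M) y = inl x /\ place (mref0 M) y = q.

(* A step (e, true) traverses e forwards, (e, false) backwards. *)
Fixpoint is_path (R : realType) (G : wgraph R) (x : vtx G)
    (P : seq (edge G * bool)) (y : vtx G) : bool :=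
  if P is (e, b) :: P' then
    ((if b then edge_tail e else edge_head e) == x)
      && is_path (if b then edge_head e else edge_tail e) P' y
  else x == y.

Definition path_chain (R : realType) (G : wgraph R)
    (P : seq (edge G * bool)) : {ffun edge G -> int} :=
  [ffun e => (count_mem (e, true) P)%:Z - (count_mem (e, false) P)%:Z].

(* The image of \int_a under Omega(G)^* ~ Omega(Gamma)^*, where G is the      *)
(* graph of M: both Omega(G) and Omega(Gamma) are identified with Omega of    *)
(* the common refinement, compatibly with integration.                        *)
Definition model_functional (R : realType) (Gamma : wgraph R)
    (M : model Gamma) (a : {ffun edge (mgraph M) -> int}) :
    Omega_dual Gamma :=
  linfun (fun w : subvs_of (Omega Gamma) =>
    integral (refine (mref M) (real_chain a))
             (refine (mref0 M) (vsval w)) : R^o).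

Lemma model_functionalE (R : realType) (Gamma : wgraph R) (M : model Gamma)
    (a : {ffun edge (mgraph M) -> int}) (w : subvs_of (Omega Gamma)) :
  model_functional a w =
  integral (refine (mref M) (real_chain a)) (refine (mref0 M) (vsval w)).
Proof.
rewrite /model_functional linfun_linearE // => k u v.
rewrite -integral_is_linear; congr integral.
by apply/ffunP => e; rewrite linearP !ffunE.
Qed.

(* The value does not depend on the choice of M and P. *)
Definition AbelJacobi (R : realType) (Gamma : wgraph R) (p q : curve_point Gamma) :
    Jac Gamma :=
  xget 0 [set c | exists (M : model Gamma) (x y : vtx (mgraph M))
                         (P : seq (edge (mgraph M) * bool)),
    [/\ vertex_at x p, vertex_at y q, is_path x P y
      & c = toJac (model_functional (path_chain P))]]%classic.

Definition collapsed (R : realType) (Gamma : wgraph R) (p : curve_point Gamma)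
    (e : edge Gamma) : Prop :=
  exists c : Jac Gamma, forall t : R, 0 <= t <= len e ->
    AbelJacobi p (segment e t) = c.

Definition OmegaZ (R : realType) (Gamma : wgraph R)
    (w : subvs_of (Omega Gamma)) : Prop :=
  forall e, vsval w e \is a Num.int.

Definition OmegaZ_dual (R : realType) (Gamma : wgraph R)
    (s : Omega_dual Gamma) : Prop :=
  forall w, OmegaZ w -> s w \is a Num.int.

Definition primitive (R : realType) (Gamma : wgraph R)
    (s : Omega_dual Gamma) : Prop :=
  OmegaZ_dual s /\
  ~ exists (t : nat) (s' : Omega_dual Gamma),
      [/\ (1 < t)%N, OmegaZ_dual s' & s = t%:R *: s'].

(* Tropical length; junk value 0 when v is not a multiple of a primitive      *)
(* vector.                                                                    *)
Definition trop_length (R : realType) (Gamma : wgraph R)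
    (v : Omega_dual Gamma) : R :=
  xget 0 [set c | exists (t : R) (l : Omega_dual Gamma),
    [/\ primitive l, v = t *: l & c = `|t|]]%classic.

(* The path t |-> Phi_p(e(t)) lifts to t |-> v + t l for some v: then l is    *)
(* the image under the differential of Phi_p of the unit tangent vector d/dt. *)
Definition AJ_velocity (R : realType) (Gamma : wgraph R) (p : curve_point Gamma)
    (e : edge Gamma) (l : Omega_dual Gamma) : Prop :=
  exists v : Omega_dual Gamma, forall t : R, 0 <= t <= len e ->
    AbelJacobi p (segment e t) = toJac (v + t *: l).

Definition image_length (R : realType) (Gamma : wgraph R) (e : edge Gamma)
    (l : Omega_dual Gamma) : R := len e * trop_length l.

(* Main.v *)
Require Import Defs.
From HB Require Import structures.
From mathcomp Require Import all_boot all_order all_algebra.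
From mathcomp Require Import all_classical reals.
From mathcomp Require Import ring lra.
Import Order.TTheory GRing.Theory Num.Theory.
Local Open Scope ring_scope.

Set Implicit Arguments.
Unset Strict Implicit.
Unset Printing Implicit Defensive.

(** Write l_e for the functional sending a harmonic form w to its coefficient
w_e.  Moving along the segment e from coordinate s to coordinate t integrates
w_e de over a length t - s, so Phi_p(e(t)) lifts to v + t l_e, and l_e is the
velocity (AJ_velocity_edge_coef).  It is the only one: H_1(Gamma, Z) is discrete
in the dual of the harmonic forms, hence contains no segment (H1Z_line_eq0).

If e is not collapsed then l_e is nonzero, so some harmonic form is nonzero on
e.  The flow of a harmonic form across a bridge vanishes, so e is not a bridge
(harmonic_bridge), and a path joining its ends in the rest of the graph closes
up to an integer cycle which has coefficient 1 on e, that is, an integer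
harmonic form w with l_e(w) = 1 (integer_form_coef1).  Since l_e takes integer
values on integer forms, it is then primitive, and its tropical length is 1
(trop_length_scale).

Most of the work goes into giving a value to Phi_p, which requires that models
containing two given points exist and that all models and paths agree modulo
periods.  For the second point, all functionals that deserve to be called
integrals along paths from z1 to z2 are described at once, on the preferred
model only: push each point back along its segment to the tail vertex of that
segment, take an integer chain joining the two vertices, and correct by the two
partial segments (path_functional).  This family is stable under concatenation
and reversal, any two of its members with the same ends differ by a period
(path_functional_toJac), and it contains the integral over every subsegment.  An
edge of an arbitrary model is a concatenation of edges of the common refinement
(edge_concatenation), each of which is a subsegment of the preferred model; so
every path in every model gives a member (path_functional_model).  Existence is
obtained by cutting the preferred model at finitely many interior points
(subdivision). *)

(** * Chains and paths in a graph *)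

Section Chains.
Variables (R : realType) (G : wgraph R).
Implicit Types (e : edge G) (x y : vtx G).

Lemma boundaryD (A : zmodType) (a b : {ffun edge G -> A}) x :
  boundary (a + b) x = boundary a x + boundary b x.
Proof.
rewrite /boundary; under eq_bigr do rewrite ffunE.
under [X in _ - X]eq_bigr do rewrite ffunE.
by rewrite !big_split /= opprD addrACA.
Qed.

Lemma boundaryN (A : zmodType) (a : {ffun edge G -> A}) x :
  boundary (- a) x = - boundary a x.
Proof.
rewrite /boundary; under eq_bigr do rewrite ffunE.
under [X in _ - X]eq_bigr do rewrite ffunE.
by rewrite !sumrN opprD.
Qed.

Lemma boundary0 (A : zmodType) x : boundary (0 : {ffun edge G -> A}) x = 0.
Proof. by rewrite /boundary !big1 ?subrr // => e _; rewrite ffunE. Qed.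

Definition edge_chain e : {ffun edge G -> int} := [ffun e' => (e' == e)%:R].

Lemma boundary_edge_chain e x :
  boundary (edge_chain e) x = (x == edge_head e)%:R - (x == edge_tail e)%:R.
Proof.
have sum1 (f : edge G -> vtx G) :
    \sum_(e' | f e' == x) edge_chain e e' = (x == f e)%:R.
  rewrite big_mkcond (bigD1 e) //= ffunE eqxx big1 ?addr0 => [|e' ne].
    by rewrite eq_sym; case: eqP.
  by rewrite ffunE (negbTE ne) if_same.
by rewrite /boundary !sum1.
Qed.

Definition step_chain (s : edge G * bool) : {ffun edge G -> int} :=
  if s.2 then edge_chain s.1 else - edge_chain s.1.

Lemma path_chain_cons (s : edge G * bool) P :
  path_chain (s :: P) = step_chain s + path_chain P.
Proof.
case: s => e b; apply/ffunP => e'; rewrite /step_chain !ffunE /=.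
rewrite !xpair_eqE eq_sym; case: b; rewrite ?andbT ?andbF !ffunE !PoszD /=.
  by case: eqP; rewrite /= ?add0r ?addrA.
by case: eqP; rewrite /= ?oppr0 ?add0r // opprD addrCA.
Qed.

Lemma path_chain_nil : path_chain [::] = 0 :> {ffun edge G -> int}.
Proof. by apply/ffunP => e; rewrite !ffunE subrr. Qed.

(** Lets a property of integrals be checked on single edges when it is stable
under concatenation and reversal of paths. *)
Lemma path_chain_ind (A : zmodType) (L : vtx G -> vtx G -> A -> Prop)
    (f : {additive {ffun edge G -> int} -> A}) :
    (forall x, L x x 0) ->
    (forall x y z u v, L x y u -> L y z v -> L x z (u + v)) ->
    (forall x y u, L x y u -> L y x (- u)) ->
    (forall e, L (edge_tail e) (edge_head e) (f (edge_chain e))) ->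
  forall P x y, is_path x P y -> L x y (f (path_chain P)).
Proof.
move=> L0 LD LN Le; elim=> [|[e b] P IH] x y /=.
  by move=> /eqP->; rewrite path_chain_nil raddf0.
move=> /andP[/eqP<- /IH Lp]; rewrite path_chain_cons raddfD /=.
apply: LD Lp; rewrite /step_chain /=; case: (b); first exact: Le.
by rewrite raddfN; apply: LN.
Qed.

Lemma boundary_path_chain P x y z : is_path x P y ->
  boundary (path_chain P) z = (z == y)%:R - (z == x)%:R.
Proof.
elim: P x => [|[e b] P IH] x /=.
  by move=> /eqP->; rewrite path_chain_nil boundary0 subrr.
move=> /andP[/eqP<- /IH Pz]; rewrite path_chain_cons boundaryD Pz /step_chain /=.
by case: (b); rewrite ?boundaryN boundary_edge_chain; ring.
Qed.

(** With Q = predT this is adjacency in G, with Q = (!= e) adjacency after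
deletion of e. *)
Definition adjacent_via (Q : pred (edge G)) : rel (vtx G) := fun a b =>
  [exists (e | Q e), ((edge_tail e == a) && (edge_head e == b))
                  || ((edge_tail e == b) && (edge_head e == a))].

Lemma connect_is_path Q x y : connect (adjacent_via Q) x y ->
  exists2 P, is_path x P y & all (fun s => Q s.1) P.
Proof.
move=> /connectP[p pp ->]; elim: p x pp => [|z p IH] x /=.
  by exists [::] => //=.
move=> /andP[/exists_inP[e Qe xz] /IH[P Pz QP]].
by case/orP: xz => /andP[/eqP ex /eqP ez];
   [exists ((e, true) :: P)|exists ((e, false) :: P)];
   rewrite /= ?Qe // ?ex ?ez eqxx.
Qed.

Lemma is_path_exists x y : exists P, is_path x P y.
Proof.
have [|P] := @connect_is_path predT x y; last by exists P.
rewrite (@eq_connect _ _ (fun a b => [exists e,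
   ((edge_tail e == a) && (edge_head e == b))
   || ((edge_tail e == b) && (edge_head e == a))])) ?wgraph_connected //.
Qed.

End Chains.

(** * Functionals on harmonic forms attached to paths *)

Section Functionals.
Variables (R : realType) (G : wgraph R).
Implicit Types (e : edge G) (x y : vtx G) (z : curve_point G).

Fact edge_coef_is_linear e (k : R) (u v : subvs_of (Omega G)) :
  vsval (k *: u + v) e = k * vsval u e + vsval v e.
Proof. by rewrite linearP !ffunE. Qed.

Definition edge_coef e : Omega_dual G :=
  linfun (fun w : subvs_of (Omega G) => vsval w e : R^o).

Lemma edge_coefE e w : edge_coef e w = vsval w e.
Proof. by rewrite /edge_coef linfun_linearE //; apply: edge_coef_is_linear. Qed.

Definition period (a : {ffun edge G -> int}) : Omega_dual G :=
  int_functional (real_chain a).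

Lemma periodE a w : period a w = \sum_e (a e)%:~R * vsval w e * len e.
Proof.
by rewrite /period int_functionalE; apply: eq_bigr => e _; rewrite ffunE.
Qed.

Fact period_is_zmod_morphism : zmod_morphism period.
Proof.
move=> a b; apply/lfunP => w; rewrite !lfunE /= lfunE /= !periodE -sumrB.
by apply: eq_bigr => e _; rewrite !ffunE rmorphB /= !mulrBl.
Qed.

HB.instance Definition _ := GRing.isZmodMorphism.Build
  {ffun edge G -> int} (Omega_dual G) period period_is_zmod_morphism.

Lemma period_edge_chain e : period (edge_chain e) = len e *: edge_coef e.
Proof.
apply/lfunP => w; rewrite lfunE /= periodE edge_coefE (bigD1 e) //= big1.
  by rewrite ffunE eqxx mul1r addr0 [RHS]mulrC.
by move=> e' /negbTE ne; rewrite ffunE ne !mul0r.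
Qed.

Definition anchor z : vtx G :=
  match z with inl x => x | inr u => edge_tail (sval u).1 end.

Definition offset z : Omega_dual G :=
  match z with inl _ => 0 | inr u => (sval u).2 *: edge_coef (sval u).1 end.

(** A path from z1 to z2 is homotopic, up to its first and last partial
segments, to a path between vertices of G.  Anchoring an interior point at the
tail of its segment makes these corrections depend on the endpoints alone. *)
Definition path_functional z1 z2 (s : Omega_dual G) : Prop :=
  exists2 a : {ffun edge G -> int},
    forall x, boundary a x = (x == anchor z2)%:R - (x == anchor z1)%:R
  & s = period a + offset z2 - offset z1.

Lemma path_functional0 z : path_functional z z 0.
Proof.
by exists 0 => [x|]; rewrite ?boundary0 ?subrr // raddf0 add0r subrr.
Qed.

Lemma path_functionalD z1 z2 z3 s t :
  path_functional z1 z2 s -> path_functional z2 z3 t ->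
  path_functional z1 z3 (s + t).
Proof.
move=> [a ba ->] [b bb ->]; exists (a + b) => [x|].
  by rewrite boundaryD ba bb; ring.
rewrite raddfD /= -!addrA; congr (_ + _).
by rewrite addrC -!addrA addNr addr0 addrC -!addrA.
Qed.

Lemma path_functionalN z1 z2 s :
  path_functional z1 z2 s -> path_functional z2 z1 (- s).
Proof.
move=> [a ba ->]; exists (- a) => [x|]; first by rewrite boundaryN ba opprB.
by rewrite raddfN /= !opprD opprK -!addrA; congr (_ + _); rewrite addrC.
Qed.

Lemma toJac_eq s t : (toJac s == toJac t) = (s - t \in @H1Z R G).
Proof. by rewrite /toJac -Quotient.idealrBE. Qed.

(** The offsets cancel in the difference of two such functionals, which leaves
the period of a cycle. *)
Lemma path_functional_toJac z1 z2 s t :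
  path_functional z1 z2 s -> path_functional z1 z2 t -> toJac s = toJac t.
Proof.
move=> zs /path_functionalN zt; have [a ba E] := path_functionalD zs zt.
apply/eqP; rewrite toJac_eq; apply/asboolP; exists a.
split=> [x|]; first by rewrite ba subrr.
by rewrite E addrK.
Qed.

Lemma segment_in e t (et : 0 < t < len e) :
  segment e t = inr (exist (fun x : edge G * R => 0 < x.2 < len x.1) (e, t) et).
Proof.
rewrite /segment; case: insubP => [u _ E|/=]; last by rewrite et.
by congr inr; apply: val_inj.
Qed.

Lemma segment_le0 e t : t <= 0 -> segment e t = inl (edge_tail e).
Proof.
move=> t0; rewrite /segment insubN ?t0 //=.
by rewrite negb_and -leNgt t0.
Qed.

Lemma segment_ge_len e t : len e <= t -> segment e t = inl (edge_head e).
Proof.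
move=> te; rewrite /segment insubN /=; first last.
  by rewrite negb_and -!leNgt te orbT.
by rewrite leNgt (lt_le_trans (len_gt0 e) te).
Qed.

(** The two ends of the segment are vertices and carry no offset; at the head,
the chain e itself supplies the whole length. *)
Lemma path_functional_tail_segment e t : 0 <= t <= len e ->
  path_functional (inl (edge_tail e)) (segment e t) (t *: edge_coef e).
Proof.
move=> /andP[]; rewrite le_eqVlt => /predU1P[<- _|t0].
  by rewrite segment_le0 // scale0r; apply: path_functional0.
rewrite le_eqVlt => /predU1P[->|te].
  rewrite segment_ge_len //; exists (edge_chain e) => [x|].
    exact: boundary_edge_chain.
  by rewrite period_edge_chain /= subr0 addr0.
have et : 0 < t < len e by rewrite t0.
rewrite (segment_in et); exists 0 => [x|]; first by rewrite boundary0 subrr.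
by rewrite raddf0 /= subr0 add0r.
Qed.

Lemma path_functional_segment e (s t : R) : 0 <= s <= len e -> 0 <= t <= len e ->
  path_functional (segment e s) (segment e t) ((t - s) *: edge_coef e).
Proof.
move=> se te; rewrite scalerBl addrC.
exact: path_functionalD (path_functionalN (path_functional_tail_segment se))
  (path_functional_tail_segment te).
Qed.

Lemma path_functional_exists z1 z2 : exists s, path_functional z1 z2 s.
Proof.
have [P xPy] := is_path_exists (anchor z1) (anchor z2).
exists (period (path_chain P) + offset z2 - offset z1); exists (path_chain P) => //.
by move=> x; rewrite (boundary_path_chain _ xPy).
Qed.

End Functionals.

(** * Edges as concatenations of the pieces of a refinement *)

Section Refinements.
Variables (R : realType) (G G' : wgraph R) (r : refinement G G').

Lemma host_start_uniq (e1 e2 : edge G') (t : R) : host r e1 = host r e2 ->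
  start r e1 <= t < start r e1 + len e1 -> start r e2 <= t < start r e2 + len e2 ->
  e1 = e2.
Proof.
move=> h12 t1 t2; have t0 : 0 <= t < len (host r e1).
  case/andP: t1 => s1 t1; rewrite (le_trans (start_ge0 r e1)) //.
  exact: lt_le_trans t1 (end_le r e1).
by have [e [_ eq_e]] := host_cover r t0; rewrite -(eq_e e1) ?(eq_e e2).
Qed.

(** The pieces of e, taken by increasing start, form a chain of consecutive
edges: the piece covering the endpoint of a piece e' cannot start earlier, since
it would then overlap e', so it starts exactly there, and the two endpoints are
placed at the same point.  The sum over the pieces that start at or after e' is
therefore attached to the path from the tail of e' to the end of e, by induction
on the number of such pieces.  The relation L abstracts from the functionals
attached to these paths. *)
Lemma edge_concatenation (A : zmodType) (L : vtx G' -> vtx G' -> A -> Prop)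
    (f : edge G' -> A) :
    (forall x y z u v, L x y u -> L y z v -> L x z (u + v)) ->
    (forall e', L (edge_tail e') (edge_head e') (f e')) ->
  forall e x y, place r x = inl (edge_tail e) -> place r y = inl (edge_head e) ->
  L x y (\sum_(e' | host r e' == e) f e').
Proof.
move=> LD Lf e x y px py.
have head_end e' : host r e' = e -> start r e' + len e' = len e -> edge_head e' = y.
  move=> h' E; apply: (place_inj (r := r)).
  by rewrite place_head E h' segment_ge_len.
have after e' : host r e' = e ->
    L (edge_tail e') y (\sum_(e1 | (host r e1 == e) && (start r e' <= start r e1)) f e1).
  have [n] := ubnP #|[pred e1 | (host r e1 == e) && (start r e' <= start r e1)]|.
  elim: n e' => // n IH e' le_n h'.
  rewrite (bigD1 e') ?h' ?eqxx ?lexx //=.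
  have := end_le r e'; rewrite h' le_eqVlt => /predU1P[E|lt_e].
    rewrite big1 ?addr0 => [|e1 /andP[/andP[/eqP h1 s1] ne]].
      by have := Lf e'; rewrite (head_end e').
    have := end_le r e1; rewrite h1 -E => l1.
    case/eqP: ne; apply: (@host_start_uniq _ _ (start r e1)); rewrite ?h1 ?h' //.
      by rewrite lexx ltrDl len_gt0.
    by rewrite s1 (lt_le_trans _ l1) // ltrDl len_gt0.
  have t0 : 0 <= start r e' + len e' < len e.
    by rewrite lt_e andbT addr_ge0 ?start_ge0 // ltW ?len_gt0.
  have [e2 [[h2 /andP[s2 lt2]] _]] := host_cover r t0.
  have l' := len_gt0 e'; have l2 := len_gt0 e2.
  (* e2 is the piece covering the endpoint of e'. *)
  have E2 : start r e2 = start r e' + len e'.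
    apply/eqP; rewrite eq_le s2 leNgt; apply/negP => lt2'.
    have E : e2 = e'.
      (* The later of the two starts is a coordinate common to both pieces. *)
      apply: (@host_start_uniq _ _ (Num.max (start r e2) (start r e'))).
      - by rewrite h2.
      - by rewrite le_max (lexx (start r e2)) gt_max ltrDl l2 (lt_trans _ lt2) ?ltrDl.
      - by rewrite le_max (lexx (start r e')) orbT gt_max lt2' ltrDl.
    by rewrite E ltxx in lt2.
  have Etail : edge_head e' = edge_tail e2.
    by apply: (place_inj (r := r)); rewrite place_head place_tail h' h2 E2.
  rewrite (eq_bigl (fun e1 => (host r e1 == e) && (start r e2 <= start r e1))).
    apply: LD (Lf e') _; rewrite Etail; apply: IH => //.
    rewrite -ltnS; apply: leq_ltn_trans le_n; apply: proper_card; apply/properP; split.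
      apply/fintype.subsetP => e1; rewrite !inE => /andP[-> /=]; lra.
    exists e'; rewrite !inE ?h' ?eqxx ?lexx //= -ltNge; lra.
  move=> e1 /=; have [h1|//] := eqVneq (host r e1) e; rewrite /=.
  apply/andP/idP => [[s1 ne]|s1].
    rewrite leNgt; apply/negP => lt1; case/eqP: ne.
    apply: (@host_start_uniq _ _ (start r e1)); rewrite ?h1 ?h' //.
      by rewrite lexx ltrDl len_gt0.
    by rewrite s1 -E2.
  split; first by apply: le_trans s1; rewrite E2 lerDl ltW.
  by apply/eqP => E; move: s1; rewrite E E2 gerDl leNgt l'.
have t0 : (0 : R) <= 0 < len e by rewrite lexx len_gt0.
have [e' [[h' /andP[s' _]] _]] := host_cover r t0.
have s0 : start r e' = 0 by apply/le_anti; rewrite s' start_ge0.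
have -> : x = edge_tail e'.
  by apply: (place_inj (r := r)); rewrite place_tail s0 segment_le0 // h'.
rewrite (eq_bigl (fun e1 => (host r e1 == e) && (start r e' <= start r e1))).
  exact: after.
by move=> e1 /=; rewrite s0 start_ge0 andbT.
Qed.

End Refinements.

(** * Integration along paths in an arbitrary model *)

Section Models.
Variables (R : realType) (Gamma : wgraph R).

Fact model_functional_is_zmod_morphism (M : model Gamma) :
  zmod_morphism (@model_functional R Gamma M).
Proof.
move=> a b; apply/lfunP => w; rewrite !lfunE /= lfunE /= !model_functionalE.
rewrite -sumrB; apply: eq_bigr => e _.
by rewrite !ffunE rmorphB /= !mulrBl.
Qed.

HB.instance Definition _ (M : model Gamma) := GRing.isZmodMorphism.Build
  {ffun edge (mgraph M) -> int} (Omega_dual Gamma) (@model_functional R Gamma M)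
  (@model_functional_is_zmod_morphism M).

Lemma model_functional_edge (M : model Gamma) (e : edge (mgraph M)) :
  model_functional (edge_chain e) =
  \sum_(e' | host (mref M) e' == e) len e' *: edge_coef (host (mref0 M) e').
Proof.
apply/lfunP => w; rewrite model_functionalE sum_lfunE /integral.
rewrite [RHS]big_mkcond /=; apply: eq_bigr => e' _; rewrite !ffunE lfunE /= edge_coefE.
by case: eqP => _; rewrite ?mul0r // mul1r [RHS]mulrC.
Qed.

Lemma path_functional_model (M : model Gamma) P (x y : vtx (mgraph M)) p q :
  vertex_at x p -> vertex_at y q -> is_path x P y ->
  path_functional p q (model_functional (path_chain P)).
Proof.
move=> [x' [px <-]] [y' [py <-]] xPy.
pose place0 := place (mref0 M).
(* A vertex of the model meets the preferred model only through the vertex of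
   the common refinement that lies above it. *)
pose L (x y : vtx (mgraph M)) s := forall x' y', place (mref M) x' = inl x ->
  place (mref M) y' = inl y -> path_functional (place0 x') (place0 y') s.
suff : L x y (model_functional (path_chain P)) by apply.
apply: (@path_chain_ind _ _ _ L) xPy => {p q x y x' y' px py}.
- move=> x x' y' <- /place_inj->; exact: path_functional0.
- move=> x y z s t xy yz x' z' px pz; have [y' py] := place_vtx (mref M) y.
  exact: path_functionalD (xy _ _ px py) (yz _ _ py pz).
- by move=> x y s xy y' x' py px; apply: path_functionalN; apply: xy.
move=> e x y px py; rewrite /= model_functional_edge.
pose L' x y s := path_functional (place0 x) (place0 y) s.
apply: (@edge_concatenation _ _ _ _ _ L') px py => [x1 y1 z1 s t|e'].
  exact: path_functionalD.
have l' := len_gt0 e'; have := end_le (mref0 M) e'; have := start_ge0 (mref0 M) e'.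
move=> s0 le; rewrite /L' /place0 place_tail place_head.
rewrite -[X in X *: _](addrK (start (mref0 M) e')) [X in (X - _) *: _]addrC.
apply: path_functional_segment; lra.
Qed.

End Models.

(** * Cutting a graph at finitely many interior points *)

Section Subdivision.
Variables (R : realType) (G : wgraph R).
Variable S : seq {x : edge G * R | 0 < x.2 < len x.1}.

Definition cut : finType := seq_sub S.
Definition cut_edge (c : cut) : edge G := (sval (val c)).1.
Definition cut_pos (c : cut) : R := (sval (val c)).2.

Lemma cut_posP c : 0 < cut_pos c < len (cut_edge c).
Proof. exact: (svalP (val c)). Qed.

Lemma cut_inj c d : cut_edge c = cut_edge d -> cut_pos c = cut_pos d -> c = d.
Proof.
move=> ce cp; apply/val_inj/val_inj; move: ce cp; rewrite /cut_edge /cut_pos /=.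
by case: (sval _) => ? ?; case: (sval _) => ? ? /= -> ->.
Qed.

Definition sub_vtx : finType := (vtx G + cut)%type.
(** An edge of the subdivision is named after its starting point: an edge of G
for the first piece of this edge, a cut for the piece that begins there. *)
Definition sub_edge : finType := (edge G + cut)%type.

Definition sub_host (e : sub_edge) : edge G :=
  match e with inl e => e | inr c => cut_edge c end.
Definition sub_start (e : sub_edge) : R :=
  match e with inl _ => 0 | inr c => cut_pos c end.

Definition later (e : sub_edge) : pred cut := fun c =>
  (cut_edge c == sub_host e) && (sub_start e < cut_pos c).
Definition next (e : sub_edge) : option cut :=
  if [pick c | later e c] is Some c0
  then Some [arg min_(c < c0 | later e c) cut_pos c]%O else None.

Variant next_spec (e : sub_edge) : option cut -> Prop :=
  | NextSome c of cut_edge c = sub_host e & sub_start e < cut_pos c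
      & (forall d, later e d -> cut_pos c <= cut_pos d) : next_spec e (Some c)
  | NextNone of (forall d, ~~ later e d) : next_spec e None.

Lemma nextP e : next_spec e (next e).
Proof.
rewrite /next; case: pickP => [c0 l0|none]; last first.
  by constructor => d; rewrite none.
by case: arg_minP => // c /andP[/eqP ce cp] min_c; constructor.
Qed.

Definition sub_tail (e : sub_edge) : sub_vtx :=
  match e with inl e => inl (edge_tail e) | inr c => inr c end.
Definition sub_head (e : sub_edge) : sub_vtx :=
  if next e is Some c then inr c else inl (edge_head (sub_host e)).
Definition sub_end (e : sub_edge) : R :=
  if next e is Some c then cut_pos c else len (sub_host e).
Definition sub_len (e : sub_edge) : R := sub_end e - sub_start e.

Lemma sub_startP e : 0 <= sub_start e < len (sub_host e).
Proof.
case: e => [e|c] /=; first by rewrite lexx len_gt0.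
by have /andP[/ltW-> ->] := cut_posP c.
Qed.

Lemma sub_len_gt0 e : 0 < sub_len e.
Proof.
rewrite /sub_len /sub_end subr_gt0; case: nextP => // _.
by case/andP: (sub_startP e).
Qed.

Lemma sub_end_le e : sub_end e <= len (sub_host e).
Proof.
rewrite /sub_end; case: nextP => // c <- _ _.
by have /andP[_ /ltW] := cut_posP c.
Qed.

Definition sub_adj : rel sub_vtx := fun a b =>
  [exists e, ((sub_tail e == a) && (sub_head e == b))
          || ((sub_tail e == b) && (sub_head e == a))].

Lemma sub_adj_sym : connect_sym sub_adj.
Proof.
apply: sym_connect_sym => a b.
by apply: eq_existsb => e; rewrite orbC.
Qed.

(** By induction on the number of cuts beyond the start of the piece. *)
Lemma connect_head e : connect sub_adj (sub_tail e) (inl (edge_head (sub_host e))).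
Proof.
have [n] := ubnP #|later e|; elim: n e => // n IH e le_n.
have step : connect sub_adj (sub_tail e) (sub_head e).
  by apply/connect1/existsP; exists e; rewrite !eqxx.
move: step; rewrite /sub_head; case: nextP => // c ce cp min_c step.
apply: connect_trans step _; rewrite -ce; apply: (IH (inr c)).
rewrite -ltnS; apply: leq_ltn_trans le_n; apply: proper_card.
apply/properP; split.
  apply/fintype.subsetP => d; rewrite !unfold_in /later /= ce => /andP[-> /=].
  exact: lt_trans.
by exists c; rewrite unfold_in /later /= ?ce ?eqxx // ltxx.
Qed.

Lemma sub_vtx_neq0 : (0 < #|sub_vtx|)%N.
Proof. by rewrite card_sum (leq_trans (vtx_neq0 G)) ?leq_addr. Qed.

Lemma sub_connected (x y : sub_vtx) : connect sub_adj x y.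
Proof.
have old a b : connect sub_adj (inl a) (inl b).
  have /connectP[p pp ->] := wgraph_connected a b.
  elim: p a pp => [|c p IH] a //= /andP[/existsP[e ac] /IH]; apply: connect_trans.
  have := connect_head (inl e).
  by case/orP: ac => /andP[/eqP<- /eqP<-] //; rewrite sub_adj_sym.
have to_old z : exists a, connect sub_adj z (inl a).
  case: z => [a|c]; first by exists a.
  by exists (edge_head (cut_edge c)); apply: (connect_head (inr c)).
have [[a xa] [b yb]] := (to_old x, to_old y).
by rewrite (connect_trans xa) // (connect_trans (old a b)) // sub_adj_sym.
Qed.

Definition subdivision : wgraph R :=
  WGraph sub_len_gt0 sub_vtx_neq0 sub_connected.

Definition sub_place (x : vtx subdivision) : curve_point G :=
  match x with inl x => inl x | inr c => inr (val c) end.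

Lemma sub_place_inj : injective sub_place.
Proof. by move=> [x|c] [y|d] //= [E]; rewrite ?E //; congr inr; apply: val_inj. Qed.

Lemma segment_cut c : segment (cut_edge c) (cut_pos c) = inr (val c).
Proof.
rewrite (segment_in (cut_posP c)); congr inr; apply: val_inj.
by rewrite /= /cut_edge /cut_pos -surjective_pairing.
Qed.

Lemma sub_place_tail (e : edge subdivision) :
  sub_place (edge_tail e) = segment (sub_host e) (sub_start e).
Proof.
by case: e => [e|c]; [rewrite segment_le0|apply/esym/segment_cut].
Qed.

Lemma sub_place_head (e : edge subdivision) :
  sub_place (edge_head e) = segment (sub_host e) (sub_start e + len e).
Proof.
rewrite /= /sub_len addrC subrK /sub_head /sub_end.
by case: nextP => [c <- _ _|_]; [apply/esym/segment_cut|rewrite segment_ge_len].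
Qed.

(** The piece covering t is the one with the greatest start not exceeding t. *)
Lemma sub_host_cover e t : 0 <= t < len e ->
  exists! e' : edge subdivision,
    sub_host e' = e /\ sub_start e' <= t < sub_start e' + len e'.
Proof.
move=> /andP[t0 te].
pose Q (e' : sub_edge) := (sub_host e' == e) && (sub_start e' <= t).
have Qe : Q (inl e) by rewrite /Q /= eqxx.
case: (@arg_maxP _ _ _ (inl e : sub_edge) Q sub_start Qe).
move=> e1 /andP[/eqP h1 s1] max1.
have end1 : t < sub_end e1.
  rewrite /sub_end; case: nextP => [c ce cp _|_]; last by rewrite h1.
  rewrite ltNge; apply/negP => ct.
  by have := max1 (inr c); rewrite /Q /= ce h1 eqxx ct leNgt cp => /(_ isT).
have lenE (e' : sub_edge) : sub_start e' + sub_len e' = sub_end e'.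
  by rewrite addrC subrK.
exists e1; split=> [|e2]; first by rewrite /= lenE s1.
rewrite /= lenE => -[h2 /andP[s2 end2]].
have : sub_start e2 <= sub_start e1 by apply: max1; rewrite /Q h2 eqxx.
rewrite le_eqVlt => /predU1P[E|lt21].
  move: E h1 h2 => {max1 s1 end1 s2 end2}.
  case: e1 e2 => [e1|c1] [e2|c2] /= E <- //.
  - by move=> ->.
  - by have := cut_posP c2; rewrite E ltxx.
  - by have := cut_posP c1; rewrite -E ltxx.
  by move=> /esym/cut_inj->.
case: e1 => [e1|c] in h1 s1 max1 end1 lt21 *.
  by have /andP[] := sub_startP e2; rewrite leNgt lt21.
have : sub_end e2 <= cut_pos c.
  move: h1 lt21; rewrite /sub_end /= => ce lt2c.
  have lc : later e2 c by rewrite /later ce h2 eqxx.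
  by case: nextP => [d _ _ /(_ c lc)|/(_ c)] //; rewrite lc.
by rewrite leNgt (le_lt_trans s1).
Qed.

Lemma sub_place_vtx (x : vtx G) : exists y, sub_place y = inl x.
Proof. by exists (inl x). Qed.

Lemma sub_start_ge0 e : 0 <= sub_start e.
Proof. by case/andP: (sub_startP e). Qed.

Lemma sub_edge_end_le (e : edge subdivision) : sub_start e + len e <= len (sub_host e).
Proof. by rewrite /= /sub_len addrC subrK sub_end_le. Qed.

Definition subdivision_refinement : refinement G subdivision :=
  Refinement sub_place_inj sub_place_vtx sub_start_ge0 sub_edge_end_le
    sub_place_tail sub_place_head sub_host_cover.

End Subdivision.

(** * The Abel-Jacobi map along a segment *)

Section AbelJacobiMap.
Variables (R : realType) (Gamma : wgraph R).
Implicit Types p q : curve_point Gamma.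

Lemma refinement_id (G : wgraph R) :
  exists r : refinement G G, forall x, place r x = inl x.
Proof.
have inlI : injective (fun x : vtx G => inl x : curve_point G) by move=> x y [].
have inl_onto (x : vtx G) : exists y : vtx G, inl y = inl x :> curve_point G.
  by exists x.
have ge0 (e : edge G) : 0 <= (fun=> 0 : R) e by [].
have le (e : edge G) : (fun=> 0 : R) e + len e <= len (id e) by rewrite add0r.
have tl (e : edge G) : inl (edge_tail e) = segment (id e) ((fun=> 0 : R) e).
  by rewrite segment_le0.
have hd (e : edge G) : inl (edge_head e) = segment (id e) ((fun=> 0 : R) e + len e).
  by rewrite add0r segment_ge_len.
have cover (e : edge G) (t : R) : 0 <= t < len e -> exists! e' : edge G,
    id e' = e /\ (fun=> 0 : R) e' <= t < (fun=> 0 : R) e' + len e'.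
  by move=> te; exists e; split=> [|e' [<-]]; rewrite ?add0r.
by exists (Refinement inlI inl_onto ge0 le tl hd cover).
Qed.

(** A refinement is a model of its own, with itself as the common
refinement. *)
Lemma model_exists p q : exists (M : model Gamma) (x y : vtx (mgraph M)),
  vertex_at x p /\ vertex_at y q.
Proof.
pose interior (z : curve_point Gamma) : seq {x : edge Gamma * R | 0 < x.2 < len x.1} :=
  match z with inl _ => [::] | inr u => [:: u] end.
pose S := interior p ++ interior q.
have placed z : {subset interior z <= S} -> exists x, place (subdivision_refinement S) x = z.
  case: z => [x|u] /= uS; first by exists (inl x : vtx (subdivision S)).
  by exists (inr (SeqSub (uS u (mem_head _ _))) : vtx (subdivision S)).
have [x px] : exists x, place (subdivision_refinement S) x = p.
  by apply: placed => u; rewrite mem_cat => ->.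
have [y py] : exists y, place (subdivision_refinement S) y = q.
  by apply: placed => u; rewrite mem_cat orbC => ->.
have [r1 r1E] := refinement_id (subdivision S).
by exists (Model r1 (subdivision_refinement S)), x, y; split; [exists x|exists y].
Qed.

Lemma AbelJacobiE p q s : path_functional p q s -> AbelJacobi p q = toJac s.
Proof.
move=> pqs; rewrite /AbelJacobi; case: xgetP => [c _ /=|none].
  move=> [M [x [y [P [px qy xPy ->]]]]].
  exact: path_functional_toJac (path_functional_model px qy xPy) pqs.
have [M [x [y [px qy]]]] := model_exists p q; have [P xPy] := is_path_exists x y.
by case: (none (toJac (model_functional (path_chain P)))); exists M, x, y, P.
Qed.

Lemma AJ_velocity_edge_coef p (e : edge Gamma) : AJ_velocity p e (edge_coef e).
Proof.
have [s ps] := path_functional_exists p (inl (edge_tail e)).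
exists s => t te; apply: AbelJacobiE; apply: path_functionalD ps _.
exact: path_functional_tail_segment.
Qed.

Lemma collapsed_edge_coef0 p (e : edge Gamma) : edge_coef e = 0 -> collapsed p e.
Proof.
move=> e0; have [v vE] := AJ_velocity_edge_coef p e.
by exists (toJac v) => t /vE->; rewrite e0 scaler0 addr0.
Qed.

End AbelJacobiMap.

(** * Discreteness of the period lattice *)

Section Lattice.
Variables (R : realType) (G : wgraph R).
Implicit Types (e : edge G) (w : subvs_of (Omega G)).

Definition cycle_form (a : {ffun edge G -> int}) : Defs.form G := [ffun e => (a e)%:~R].

Lemma cycle_form_harmonic a : (forall x, boundary a x = 0) -> cycle_form a \in Omega G.
Proof.
move=> ba; apply/OmegaP => x.
under eq_bigr do rewrite ffunE; under [RHS]eq_bigr do rewrite ffunE.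
rewrite -!rmorph_sum /=; congr (_%:~R); apply/eqP.
by rewrite -subr_eq0; apply/eqP/(ba x).
Qed.

(** Periods detect cycles: a real cycle u is itself a harmonic form, and its
integral against itself is the positive definite sum of the u_e^2 len e. *)
Lemma period_scale_inj (a b : {ffun edge G -> int}) (k : R) :
    (forall x, boundary a x = 0) -> (forall x, boundary b x = 0) ->
    period a = k *: period b ->
  forall e, (a e)%:~R = k * (b e)%:~R.
Proof.
move=> ba bb E e.
pose u := cycle_form a - k *: cycle_form b.
have uO : u \in Omega G by rewrite memvB ?memvZ ?cycle_form_harmonic.
pose w := Subvs uO.
have : (period a - k *: period b) w = 0 by rewrite E subrr lfunE.
rewrite !lfunE /= lfunE /= lfunE /= !periodE /= /GRing.scale /= mulr_sumr -sumrB.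
rewrite (eq_bigr (fun e => u e ^+ 2 * len e)); last first.
  by move=> e1 _; rewrite !ffunE /= /GRing.scale /=; ring.
move/eqP; rewrite psumr_eq0 => [/allP/(_ e (mem_index_enum _))/=|e1 _].
  rewrite mulf_eq0 (gt_eqF (len_gt0 e)) orbF sqrf_eq0 !ffunE subr_eq0.
  by move/eqP.
by rewrite mulr_ge0 ?sqr_ge0 // ltW ?len_gt0.
Qed.

(** If T s is the period of the integer cycle b and (T / N) s that of a, then
a = b / N is integral; for N larger than all entries of b this forces b = 0. *)
Lemma H1Z_line_eq0 (s : Omega_dual G) (T : R) : 0 < T ->
  (forall t, 0 <= t <= T -> t *: s \in @H1Z R G) -> s = 0.
Proof.
move=> T0 Hs.
have /Hs/asboolP[b [bb Eb]] : 0 <= T <= T by rewrite (ltW T0) lexx.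
pose N := (\sum_e `|b e|%N).+1.
have N0 : (0 : R) < N%:R by rewrite ltr0n.
have /Hs/asboolP[a [ba Ea]] : 0 <= T / N%:R <= T.
  by rewrite divr_ge0 ?ler_pdivrMr ?ler_peMr ?ler1n //= ?ltW.
have abE : forall e, (a e)%:~R = N%:R^-1 * (b e)%:~R :> R.
  by apply: period_scale_inj => //; rewrite /period -Ea -Eb scalerA mulrC.
have b0 e : b e = 0.
  have NaE : (N : int) * a e = b e.
    apply: (@intr_inj R); rewrite rmorphM /= abE mulrA.
    by rewrite -pmulrn divff ?mul1r ?gt_eqF.
  have le_b : (`|b e| < N)%N by rewrite ltnS (bigD1 e) //= leq_addr.
  move: le_b; rewrite -NaE abszM absz_nat; case: (eqVneq (a e) 0) => [->|]; first by rewrite mulr0.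
  by rewrite -absz_gt0 => a0; rewrite ltnNge leq_pmulr.
have : T *: s = 0.
  rewrite Eb; have -> : b = 0 by apply/ffunP => e; rewrite b0 ffunE.
  exact: (raddf0 (@period R G)).
by move/eqP; rewrite scaler_eq0 gt_eqF //= => /eqP.
Qed.

(** Subtracting the value at t = 0 from the value at t eliminates the two base
vectors, and leaves a multiple t (l' - l) in the lattice. *)
Lemma AJ_velocity_uniq p e (l l' : Omega_dual G) :
  AJ_velocity p e l -> AJ_velocity p e l' -> l' = l.
Proof.
move=> [v vl] [v' vl'].
have D t : 0 <= t <= len e -> (v' + t *: l') - (v + t *: l) \in @H1Z R G.
  by move=> te; rewrite -toJac_eq -vl // vl'.
apply/eqP; rewrite -subr_eq0; apply/eqP/(H1Z_line_eq0 (len_gt0 e)) => t te.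
have e0 : (0 : R) <= 0 <= len e by rewrite lexx ltW ?len_gt0.
have := rpredB (D t te) (D 0 e0).
by rewrite !scale0r !addr0 [v' + _]addrC [v + _]addrC opprD addrACA addrK scalerBr.
Qed.

(** Sum the harmonicity condition over the component C of the head of e in the
graph without e: every edge other than e contributes equally to the incoming and
outgoing flow of C, and e only enters. *)
Lemma harmonic_bridge e w :
  ~~ connect (adjacent_via (fun e' => e' != e)) (edge_head e) (edge_tail e) ->
  vsval w e = 0.
Proof.
move=> bridge; pose C := connect (adjacent_via (fun e' => e' != e)) (edge_head e).
have cut_off e' : e' != e -> C (edge_head e') = C (edge_tail e').
  move=> ne; apply/idP/idP => /connect_trans; apply; apply/connect1/exists_inP;
  by exists e' => //; rewrite !eqxx ?orbT.
have wO := subvsP w; move: (vsval w) wO => u /OmegaP harm.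
have sumC (f : edge G -> vtx G) :
    \sum_(x | C x) \sum_(e' | f e' == x) u e' = \sum_(e' | C (f e')) u e'.
  rewrite [RHS](partition_big f C) //; apply: eq_bigr => x Cx.
  by apply: eq_bigl => e'; case: eqP => [->|]; rewrite ?Cx ?andbF.
have := sumC (@edge_head R G); rewrite (eq_bigr _ (fun x _ => harm x)) sumC.
rewrite [RHS](bigD1 e) /=; last exact: connect0.
under [X in _ + X]eq_bigl => e'.
  rewrite (_ : _ && _ = C (edge_tail e')); last first.
    have [->|/cut_off->] := eqVneq e' e; last by rewrite andbT.
    by rewrite andbF; apply/esym/negbTE.
over.
rewrite /= => E; apply/esym/(addIr (\sum_(e' | C (edge_tail e')) u e')).
by rewrite add0r.
Qed.

End Lattice.

(** * Primitivity and tropical length *)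

Section Tropical.
Variables (R : realType) (G : wgraph R).
Implicit Types (e : edge G) (w : subvs_of (Omega G)).

Lemma integer_form_coef1 e : edge_coef e != 0 ->
  exists2 w, OmegaZ w & vsval w e = 1.
Proof.
move=> e0; have [/connect_is_path[P PP /allP Pe]|bridge] := boolP
  (connect (adjacent_via (fun e' => e' != e)) (edge_head e) (edge_tail e)).
  pose a : {ffun edge G -> int} := edge_chain e + path_chain P.
  have ba x : boundary a x = 0.
    by rewrite boundaryD boundary_edge_chain (boundary_path_chain _ PP); ring.
  exists (Subvs (cycle_form_harmonic ba)) => [e1|] /=.
    by rewrite ffunE intr_int.
  have eP b : (e, b) \notin P by apply/negP => /Pe; rewrite eqxx.
  by rewrite !ffunE eqxx !(count_memPn _) ?eP // subrr addr0.
case/eqP: e0; apply/lfunP => w.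
by rewrite edge_coefE lfunE (harmonic_bridge w bridge).
Qed.

(** If l = t s with t > 1 then l takes only multiples of t on integer forms. *)
Lemma primitive_coef1 (l : Omega_dual G) w : OmegaZ_dual l ->
  OmegaZ w -> l w = 1 -> primitive l.
Proof.
move=> lZ wZ lw; split=> // -[t [s [t1 sZ E]]].
have /intrP[n sn] := sZ w wZ.
move: lw; rewrite E lfunE /= sn /GRing.scale /= pmulrn -intrM => /eqP.
rewrite (eqr_int R _ 1) => /eqP/(congr1 absz); rewrite abszM absz_nat => /eqP.
by rewrite muln_eq1 => /andP[/eqP t_1]; rewrite t_1 in t1.
Qed.

(** When t is nonzero, a primitive m with c l = t m is an integer multiple n l of l,
where n = m(w); primitivity of m forces n = 1 or n = -1, so the length does not
depend on the decomposition. *)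
Lemma trop_length_scale (l : Omega_dual G) w (c : R) : OmegaZ_dual l ->
  OmegaZ w -> l w = 1 -> trop_length (c *: l) = `|c|.
Proof.
move=> lZ wZ lw; have pl := primitive_coef1 lZ wZ lw.
rewrite /trop_length; case: xgetP => [_ _ /= [t [m [[mZ mprim] E ->]]]|none]; last first.
  by case: (none `|c|); exists c, l.
have /intrP[n mn] := mZ w wZ.
have cE : c = t * n%:~R.
  by have := congr1 (fun s : Omega_dual G => s w) E; rewrite /= !lfunE /= lw mn /GRing.scale /= mulr1.
have [t0|t0] := eqVneq t 0; first by rewrite cE t0 mul0r.
have mE : m = n%:~R *: l.
  by apply: (scalerI t0); rewrite scalerA -cE E.
have sZ : OmegaZ_dual ((Num.sg n)%:~R *: l).
  by move=> w' /lZ lw'; rewrite lfunE /= rpredM ?intr_int.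
(* The sign is moved into the lattice vector because primitivity speaks of
   natural multipliers. *)
have mA : m = `|n|%N%:R *: ((Num.sg n)%:~R *: l).
  by rewrite scalerA mE {1}[n]intEsg mulrC intrM pmulrn.
rewrite cE normrM -intr_norm -abszE; case E1 : `|n|%N => [|[|k]].
(* For n = 0, m = 0 is twice the zero vector. *)
- case: mprim; exists 2, 0; split=> // [w' _|].
    by rewrite lfunE /= rpred0.
  by rewrite mA E1 scaler0 mulr0n scale0r.
- by rewrite mulr1.
by case: mprim; exists k.+2, ((Num.sg n)%:~R *: l); rewrite mA E1.
Qed.

End Tropical.

Theorem theorem5p2 (R : realType) (Gamma : wgraph R) (p : curve_point Gamma)
    (e : edge Gamma) (he : ~ collapsed p e) :
  exists l : Omega_dual Gamma,
    [/\ AJ_velocity p e l,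
        forall l' : Omega_dual Gamma, AJ_velocity p e l' -> l' = l,
        forall c : R, `|c| = 1 -> trop_length (c *: l) = 1
      & image_length e l = len e].
Proof.
have eZ : OmegaZ_dual (edge_coef e) by move=> w wZ; rewrite edge_coefE.
have e0 : edge_coef e != 0 by apply/eqP => /(collapsed_edge_coef0 p).
have [w wZ we] := integer_form_coef1 e0.
have trop c : trop_length (c *: edge_coef e) = `|c|.
  by apply: trop_length_scale eZ wZ _; rewrite edge_coefE.
have velocity := AJ_velocity_edge_coef p e.
exists (edge_coef e); split=> // [l' /(AJ_velocity_uniq velocity)//|c|].
  by rewrite trop.
by rewrite /image_length -[edge_coef e]scale1r trop normr1 mulr1.
Qed.
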